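(* Let $\mathcal{H}$ be an infinite-dimensional separable real Hilbert space with orthonormal basis $(e_k)_{k\in\mathbb{N}}$, let $\alpha>0$ and $\tau=\left(\alpha+\frac{1}{2}\right)^{-1}$. For $f\in\mathcal{H}$ put $f_k=\langle f, e_k\rangle_{\mathcal{H}}$, $k\in\mathbb{N}$. For $0<r\leq\infty$ let $c,C>0$ be the minimal constants such that $$\frac{1}{c}\|f\|_{\mathcal{A}_r^\alpha(\mathcal{H})}\leq\|(f_k)_{k\in\mathbb{N}}\|_{\ell_{\tau,r}}\leq C\|f\|_{\mathcal{A}_r^\alpha(\mathcal{H})}$$ for all $f\in\mathcal{H}$. Then the following hold. (i) If $r=\tau$, then $c=\left(c_1(2\alpha+1)\right)^{\alpha+\frac{1}{2}}$ and $C=\left(C_1(2\alpha+1)\right)^{\alpha+\frac{1}{2}}$. (ii) If $r=\infty$, then $c=\left(c_{1,\infty}(2\alpha+1)\right)^{\alpha+\frac{1}{2}}$ and $C=\left(C_{1,\infty}(2\alpha+1)\right)^{\alpha+\frac{1}{2}}$.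
   Context: $\mathbb{N}=\{1,2,3,\ldots\}$. All (quasi-)norm expressions, sums and suprema of nonnegative quantities take values in $[0,\infty]$. Approximation quasi-norm: for $n\in\mathbb{N}$ let $\Sigma_{n-1}(\mathcal{H})=\{\sum_{k\in\Lambda}\lambda_k e_k : \lambda_k\in\mathbb{R},\ \Lambda\subset\mathbb{N},\ \#\Lambda<n\}$ and $E_n(f)_{\mathcal{H}}=\inf\{\|f-g\|_{\mathcal{H}} : g\in\Sigma_{n-1}(\mathcal{H})\}$. For $\alpha>0$, $$\|f\|_{\mathcal{A}_r^\alpha(\mathcal{H})}=\begin{cases}\left(\sum_{n=1}^\infty (n^\alpha E_n(f)_{\mathcal{H}})^r\frac{1}{n}\right)^{\frac{1}{r}},&0<r<\infty,\\ \sup_{n\in\mathbb{N}} n^\alpha E_n(f)_{\mathcal{H}},&r=\infty.\end{cases}$$ Lorentz sequence quasi-norm: for $0<p\leq\infty$ and a bounded sequence $(f_k)_{k\in\mathbb{N}}$ with $(f_k^\ast)_{k\in\mathbb{N}}$ the non-increasing rearrangement of $(|f_k|)_{k\in\mathbb{N}}$, $$\|(f_k)_{k\in\mathbb{N}}\|_{\ell_{p,r}}=\begin{cases}\left(\sum_{n\in\mathbb{N}}(n^{\frac{1}{p}}f_n^\ast)^r\frac{1}{n}\right)^{\frac{1}{r}},&0<r<\infty,\\ \sup_{n\in\mathbb{N}}n^{\frac{1}{p}}f_n^\ast,&r=\infty.\end{cases}$$ For $1<q<\infty$, $c_1(q),C_1(q)>0$ denote the minimal constants for which $$\frac{1}{c_1(q)}\sum_{n=1}^\infty\left(\frac{1}{n}\sum_{k=n}^\infty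 a_k^q\right)^{\frac{1}{q}}\leq\sum_{n=1}^\infty a_n\leq C_1(q)\sum_{n=1}^\infty\left(\frac{1}{n}\sum_{k=n}^\infty a_k^q\right)^{\frac{1}{q}}$$ holds for all real sequences with $a_1\geq a_2\geq\ldots\geq 0$, and $c_{1,\infty}(q),C_{1,\infty}(q)>0$ denote the minimal constants for which $$\frac{1}{c_{1,\infty}(q)}\sup_{n\in\mathbb{N}}n\left(\frac{1}{n}\sum_{k=n}^\infty a_k^q\right)^{\frac{1}{q}}\leq\sup_{n\in\mathbb{N}}na_n\leq C_{1,\infty}(q)\sup_{n\in\mathbb{N}}n\left(\frac{1}{n}\sum_{k=n}^\infty a_k^q\right)^{\frac{1}{q}}$$ holds for all real sequences with $a_1\geq a_2\geq\ldots\geq 0$. *)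

(* Defs.v *)
From HB Require Import structures.
From mathcomp Require Import all_boot all_order all_algebra finmap.
From mathcomp Require Import sesquilinear.
From mathcomp Require Import all_classical all_reals all_analysis.

Set Implicit Arguments.
Unset Strict Implicit.
Unset Printing Implicit Defensive.

Import Order.TTheory GRing.Theory Num.Theory.
Import numFieldNormedType.Exports.

Local Open Scope classical_set_scope.
Local Open Scope ring_scope.

(* Sequences indexed by {1, 2, 3, ...} are encoded as functions on [nat]: the
   value at [n : nat] is the term of index [n.+1].  Exponents and constants are
   real numbers, (quasi-)norms are extended real numbers. *)

Section MinimalConstants.
Context {R : realType} {T : Type}.
Implicit Types (D : set T) (A B : T -> \bar R).

Definition lower_constants D A B : set R :=
  [set c | forall x, D x -> ((c^-1)%:E * A x <= B x)%E].

Definition upper_constants D A B : set R :=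
  [set c | forall x, D x -> (B x <= c%:E * A x)%E].

Definition is_minimal_constant (S : set R) (c : R) : Prop :=
  [/\ 0 < c, S c & forall c', 0 < c' -> S c' -> c <= c'].

(* The junk value 0, used when there is no minimal constant, is not positive,
   hence is never itself a minimal constant. *)
Definition minimal_constant (S : set R) : R :=
  xget 0 [set c | is_minimal_constant S c].

End MinimalConstants.

Section SequenceConstants.
Context {R : realType}.
Implicit Types (a : nat -> R) (q : R).

Definition nonincreasing_nonneg : set (nat -> R) :=
  [set a | (forall n, a n.+1 <= a n) /\ (forall n, 0 <= a n)].

Definition tail_mean q a (n : nat) : \bar R :=
  (poweR ((n.+1%:R^-1)%:E * \sum_(n <= k <oo) (a k `^ q)%:E) q^-1)%E.

Definition tail_sum q a : \bar R := (\sum_(0 <= n <oo) tail_mean q a n)%E.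

Definition seq_sum a : \bar R := (\sum_(0 <= n <oo) (a n)%:E)%E.

Definition tail_sup q a : \bar R :=
  ereal_sup [set (n.+1%:R%:E * tail_mean q a n)%E | n in [set: nat]].

Definition seq_sup a : \bar R :=
  ereal_sup [set (n.+1%:R * a n)%:E | n in [set: nat]].

Definition lower_c1 q : R :=
  minimal_constant (lower_constants nonincreasing_nonneg (tail_sum q) seq_sum).

Definition upper_C1 q : R :=
  minimal_constant (upper_constants nonincreasing_nonneg (tail_sum q) seq_sum).

Definition lower_c1oo q : R :=
  minimal_constant (lower_constants nonincreasing_nonneg (tail_sup q) seq_sup).

Definition upper_C1oo q : R :=
  minimal_constant (upper_constants nonincreasing_nonneg (tail_sup q) seq_sup).

End SequenceConstants.

Section Lorentz.
Context {R : realType}.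
Implicit Types (p r : \bar R) (x : nat -> R).

(* [(\sum_(n >= 1) (n ^ beta * x_n) ^ r / n) ^ (1 / r)], and the supremum of
   [n ^ beta * x_n] when [r = +oo]; only meaningful for [0 < r]. *)
Definition weighted_qnorm (beta : R) r x : \bar R :=
  if r is r'%:E then
    poweR (\sum_(0 <= n <oo)
             ((n.+1%:R `^ beta * x n) `^ r' * n.+1%:R^-1)%:E)%E r'^-1
  else ereal_sup [set (n.+1%:R `^ beta * x n)%:E | n in [set: nat]].

(* Non-increasing rearrangement of [|x|]: the term of index [n.+1] is the least
   [s >= 0] such that at most [n] terms of [|x|] exceed [s]. *)
Definition rearrangement x (n : nat) : R :=
  inf [set s | 0 <= s /\ ([set k | s < `|x k|] #<= `I_n)%card].

(* In [\bar R] one has [+oo^-1 = 0]. *)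
Definition lorentz_qnorm p r x : \bar R :=
  weighted_qnorm (fine (p^-1)%E) r (rearrangement x).

End Lorentz.

Section Hilbert.
Context {R : realType} {H : completeNormedModType R}.

Definition norm_of_inner_product (dot : {dot H for (@idfun R)}) : Prop :=
  forall f : H, `|f| ^+ 2 = dot f f.

(* Linear combinations of fewer than [n] of the vectors [e k]. *)
Definition sparse (e : nat -> H) (n : nat) : set H :=
  [set g | exists (L : {fset nat}) (lam : nat -> R),
     (#|` L | < n)%N /\ g = \sum_(k <- L) lam k *: e k].

(* Orthonormal with dense linear span; being indexed by [nat], such a family
   exists only if [H] is infinite-dimensional and separable. *)
Definition orthonormal_basis (dot : {dot H for (@idfun R)}) (e : nat -> H) :=
  (forall i j, dot (e i) (e j) = (i == j)%:R) /\
  dense (\bigcup_n sparse e n).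

Definition approx_error (e : nat -> H) (n : nat) (f : H) : R :=
  inf [set `|f - g| | g in sparse e n].

Definition approx_qnorm (e : nat -> H) (alpha : R) (r : \bar R) (f : H) :
    \bar R :=
  weighted_qnorm alpha r (fun n => approx_error e n.+1 f).

Definition coefficients (dot : {dot H for (@idfun R)}) (e : nat -> H) (f : H) :
    nat -> R :=
  fun k => dot f (e k).

Definition coef_qnorm (dot : {dot H for (@idfun R)}) (e : nat -> H)
    (p r : \bar R) (f : H) : \bar R :=
  lorentz_qnorm p r (coefficients dot e f).

End Hilbert.

(* Main.v *)
Require Import Defs.
From HB Require Import structures.
From mathcomp Require Import all_boot all_order all_algebra.
From mathcomp Require Import sesquilinear finmap ring.
From mathcomp Require Import all_classical all_reals all_analysis.

Set Implicit Arguments.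
Unset Strict Implicit.
Unset Printing Implicit Defensive.

Import Order.TTheory GRing.Theory Num.Theory.
Import numFieldNormedType.Exports.

Local Open Scope classical_set_scope.
Local Open Scope ring_scope.

(** Let [q = 2 * alpha + 1] and [theta = alpha + 1/2 = q / 2], so that
    [tau = 1 / theta].  Write [f*] for the non-increasing rearrangement of the
    coefficients of [f] and attach to [f] its profile, the non-increasing
    sequence [a k = f* k `^ tau].

    By Pythagoras and Parseval the best approximation of [f] by [n] basis
    vectors keeps the [n] largest coefficients ([approx_errorE]), hence the
    square of its error is the tail sum of [f* k ^+ 2 = a k `^ q] over
    [k >= n] ([sqr_approx_error]).  Inserting this in the definitions, with
    [alpha * tau = 1 - 1 / q], turns the approximation quasi-norm and the
    Lorentz quasi-norm of [f] into the [theta]-th powers of the two sides of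
    the sequence inequality for [a]: the sums when [r = tau], the suprema when
    [r = +oo].  A constant [c > 0] is therefore admissible for all profiles
    exactly when [c `^ theta] is admissible for all [f], and minimal constants
    correspond in the same way ([is_minimal_constant_powR]).

    By Riesz--Fischer the profiles are exactly the non-increasing nonnegative
    sequences with [\sum_k a k `^ q] finite.  For any other sequence both sides
    of the sequence inequality are infinite and constrain no constant; this
    is a consequence of the Hardy-type inequalities [tail_sum_le] and
    [tail_sup_le].  Together with the elementary converse inequalities
    [seq_sum_le] and [seq_sup_le], they also show that the four minimal
    constants of the sequence inequalities exist at all, which the equivalences
    require.  *)

(** * Minimal constants *)

Section MinimalConstantTheory.
Context {R : realType} {T : Type}.
Implicit Types (D : set T) (A B : T -> \bar R).

(** Lower constants are upper constants with the two quantities exchanged, so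
    that only upper constants need to be studied. *)
Lemma lower_constantsE D A B (c : R) : 0 < c ->
  lower_constants D A B c <-> upper_constants D B A c.
Proof.
move=> c0; rewrite /lower_constants /upper_constants/=.
by split=> h x /h; rewrite lee_pdivrMl.
Qed.

Lemma is_minimal_constant_ext (S S' : set R) (c : R) :
  (forall x, 0 < x -> S x <-> S' x) ->
  is_minimal_constant S c <-> is_minimal_constant S' c.
Proof.
move=> SS'; split=> -[c0 Sc cmin]; split=> //; first exact/SS'.
- by move=> x x0 /(SS' _ x0); exact: cmin.
- exact/SS'.
- by move=> x x0 /(SS' _ x0); exact: cmin.
Qed.

Lemma is_minimal_lower D A B (c : R) :
  is_minimal_constant (lower_constants D A B) c <->
  is_minimal_constant (upper_constants D B A) c.
Proof. by apply: is_minimal_constant_ext => x; exact: lower_constantsE. Qed.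

Lemma minimal_constant_lower D A B :
  minimal_constant (lower_constants D A B) =
  minimal_constant (upper_constants D B A).
Proof.
rewrite /minimal_constant; congr xget; apply/seteqP.
by split=> c /is_minimal_lower.
Qed.

Lemma is_minimal_unique (S : set R) (c c' : R) :
  is_minimal_constant S c -> is_minimal_constant S c' -> c = c'.
Proof.
by move=> [c0 Sc cm] [c'0 Sc' c'm]; apply/le_anti/andP; split;
  [exact: cm | exact: c'm].
Qed.

(** The infimum of the admissible constants is again admissible, because each
    single inequality is a closed condition on the constant; the point [x0]
    keeps the infimum away from 0. *)
Lemma minimal_constantP D A B (c0 : R) (x0 : T) :
  (forall x, D x -> (0 <= A x)%E) ->
  D x0 -> A x0 = 1%E -> (1 <= B x0)%E ->
  0 < c0 -> upper_constants D A B c0 ->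
  is_minimal_constant (upper_constants D A B)
    (minimal_constant (upper_constants D A B)).
Proof.
move=> A0 Dx0 Ax0 Bx0 c00 Sc0; apply: (@xgetPex _ 0).
set S := [set c | 0 < c /\ upper_constants D A B c].
have S1 c : S c -> 1 <= c.
  move=> [_ /(_ _ Dx0)]; rewrite Ax0 mule1 => h.
  by have := le_trans Bx0 h; rewrite lee_fin.
have Sinf : has_inf S by split; [exists c0 | exists 1 => c /S1].
have m1 : 1 <= inf S by apply: lb_le_inf; [exists c0 | move=> c /S1].
have m0 : 0 < inf S by exact: lt_le_trans ltr01 m1.
exists (inf S); split => //; last first.
  by move=> c c'0 Sc; apply: ge_inf; [exists 1 => x /S1 | split].
move=> x Dx; have := A0 _ Dx; case EA : (A x) => [a| |] //= a0; last first.
  by rewrite gt0_muley ?lte_fin// leey.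
rewrite lee_fin in a0; apply/lee_addgt0Pr => e e0.
(* The denominator [a + 1] avoids a division by 0 when [a = 0]. *)
have e'0 : 0 < e / (a + 1) by rewrite divr_gt0// ltr_wpDl.
have [c [c'0 Sc] ce] := inf_adherent e'0 Sinf.
apply: (le_trans (Sc _ Dx)); rewrite EA -!EFinM -EFinD lee_fin.
apply: (le_trans (ler_wpM2r a0 (ltW ce))); rewrite mulrDl lerD2l.
rewrite mulrAC ler_pdivrMr ?ltr_wpDl// ler_wpM2l// ?ltW//.
by rewrite ltrDl.
Qed.

End MinimalConstantTheory.

Lemma ler_poweR2r {R : realType} (r : R) (x y : \bar R) :
  0 < r -> (0 <= x)%E -> (0 <= y)%E -> (poweR x r <= poweR y r)%E = (x <= y)%E.
Proof.
move=> r0 x0 y0.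
have mono (s : R) (u v : \bar R) : 0 <= s -> (0 <= u -> 0 <= v -> u <= v ->
    poweR u s <= poweR v s)%E.
  by move=> s0 u0 v0; apply: gt0_ler_poweR => //; rewrite in_itv/= leey ?u0 ?v0.
apply/idP/idP => [h|]; last exact: (mono _ _ _ (ltW r0) x0 y0).
have inv (u : \bar R) : (0 <= u)%E -> poweR (poweR u r) r^-1 = u.
  by move=> u0; rewrite -poweRrM divff ?gt_eqF// poweRe1.
by rewrite -[x]inv// -[y]inv//; apply: mono; rewrite ?poweR_ge0// invr_ge0 ltW.
Qed.

(** If the pairs [(A', B')] are the [theta]-th powers of the pairs [(A, B)],
    then a constant [c] is admissible for the latter exactly when [c `^ theta]
    is admissible for the former.  Pairs [(A x, B x) = (+oo, +oo)] may be
    missed, since they impose no condition on a positive constant. *)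
Lemma is_minimal_constant_powR {R : realType} {T T' : Type}
    (D : set T) (A B : T -> \bar R) (D' : set T') (A' B' : T' -> \bar R)
    (theta m : R) :
  0 < theta ->
  (forall x, D x -> 0 <= A x)%E -> (forall x, D x -> 0 <= B x)%E ->
  (forall y, D' y -> exists x, [/\ D x, A' y = poweR (A x) theta &
     B' y = poweR (B x) theta]) ->
  (forall x, D x -> (A x = +oo /\ B x = +oo)%E \/
     exists y, [/\ D' y, A' y = poweR (A x) theta &
     B' y = poweR (B x) theta]) ->
  is_minimal_constant (upper_constants D A B) m ->
  forall c, is_minimal_constant (upper_constants D' A' B') c <-> c = m `^ theta.
Proof.
move=> t0 A0 B0 fromD' toD' [m0 Sm mmin].
have step c x : 0 < c -> D x ->
    (poweR (B x) theta <= (c `^ theta)%:E * poweR (A x) theta)%E =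
    (B x <= c%:E * A x)%E.
  move=> c0 Dx; have cA : (0 <= c%:E * A x)%E.
    by rewrite mule_ge0 ?A0// lee_fin ltW.
  have cE0 : (0 <= c%:E)%E by rewrite lee_fin ltW.
  by rewrite -poweR_EFin -(poweRM _ cE0 (A0 _ Dx)) ler_poweR2r ?B0.
have transfer c : 0 < c ->
    upper_constants D' A' B' (c `^ theta) <-> upper_constants D A B c.
  move=> c0; split=> h.
  - move=> x Dx; case: (toD' _ Dx) => [[-> ->]|[y [D'y Ay By]]].
      by rewrite gt0_muley ?lte_fin.
    by have := h _ D'y; rewrite Ay By step.
  - by move=> y /fromD'[x [Dx -> ->]]; rewrite step//; exact: h.
suff mt : is_minimal_constant (upper_constants D' A' B') (m `^ theta).
  by move=> c; split => [/is_minimal_unique/(_ mt)|->].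
split; [exact: powR_gt0 | exact/transfer |].
move=> c c0; have -> : c = (c `^ theta^-1) `^ theta.
  by rewrite -powRrM mulVf ?gt_eqF// powRr1// ltW.
move=> /transfer -/(_ (powR_gt0 _ c0))/mmin -/(_ (powR_gt0 _ c0)) h.
by apply: ge0_ler_powR => //; rewrite ?nnegrE ?powR_ge0 ?ltW.
Qed.

(** * The constants of the sequence inequalities exist *)

Section SequenceInequalities.
Context {R : realType}.
Implicit Types (a : nat -> R) (q : R).

Lemma nneseries_le_bound (u : nat -> \bar R) (m : nat) (x : \bar R) :
  (forall n, 0 <= u n)%E -> (forall N, \sum_(m <= n < N) u n <= x)%E ->
  (\sum_(m <= n <oo) u n <= x)%E.
Proof.
move=> u0 ux; apply: lime_le; first exact: is_cvg_nneseries.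
exact: nearW.
Qed.

Lemma nonincreasing_le a m n : nonincreasing_nonneg a -> (m <= n)%N -> a n <= a m.
Proof.
move=> [da _] /subnK<-; elim: (n - m)%N => [//|k ih].
by rewrite addSn (le_trans (da _)).
Qed.

Lemma tail_mean_ge0 q a n : (0 <= tail_mean q a n)%E.
Proof. exact: poweR_ge0. Qed.

Lemma tail_sum_ge0 q a : (0 <= tail_sum q a)%E.
Proof. by apply: nneseries_ge0 => *; exact: tail_mean_ge0. Qed.

Lemma seq_sum_ge0 a : nonincreasing_nonneg a -> (0 <= seq_sum a)%E.
Proof. by move=> [_ a0]; apply: nneseries_ge0 => *; rewrite lee_fin. Qed.

Lemma tail_sup_ge0 q a : (0 <= tail_sup q a)%E.
Proof.
apply: le_ereal_sup_tmp; exists (1%:E * tail_mean q a 0)%E; first by exists 0%N.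
by rewrite mul1e tail_mean_ge0.
Qed.

Lemma seq_sup_ge0 a : nonincreasing_nonneg a -> (0 <= seq_sup a)%E.
Proof.
move=> [_ a0]; apply: le_ereal_sup_tmp; exists (1 * a 0%N)%:E; first by exists 0%N.
by rewrite mul1r lee_fin.
Qed.

Lemma sum_block_ge a p M : nonincreasing_nonneg a ->
  M%:R * a (p + M).-1 <= \sum_(p <= k < p + M) a k.
Proof.
move=> ha; rewrite mulr_natl -[X in _ *+ X](addKn p M) -sumr_const_nat.
apply: ler_sum_nat => k /andP[pk kM]; apply: nonincreasing_le => //.
by rewrite -ltnS prednK// (leq_ltn_trans _ kM).
Qed.

Lemma sum_block_le a p M : nonincreasing_nonneg a ->
  \sum_(p <= k < p + M) a k <= M%:R * a p.
Proof.
move=> ha; rewrite mulr_natl -[X in _ *+ X](addKn p M) -sumr_const_nat.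
by apply: ler_sum_nat => k /andP[pk kM]; exact: nonincreasing_le.
Qed.

Lemma nonincreasing_powR a q : 0 <= q -> nonincreasing_nonneg a ->
  nonincreasing_nonneg (fun k => a k `^ q).
Proof.
move=> q0 [da a0]; split=> n; last exact: powR_ge0.
by apply: ge0_ler_powR; rewrite ?nnegrE.
Qed.

(** The [n.+1] terms of index [n, .., n.*2] are all at least [a n.*2]. *)
Lemma tail_mean_ge q a n : 0 < q -> nonincreasing_nonneg a ->
  ((a n.*2)%:E <= tail_mean q a n)%E.
Proof.
move=> q0 ha; have a0 : 0 <= a n.*2 by case: ha.
have -> : (a n.*2)%:E = poweR (a n.*2 `^ q)%:E q^-1.
  by rewrite poweR_EFin -powRrM divff ?gt_eqF// powRr1.
have s0 : (0 <= \sum_(n <= k <oo) (a k `^ q)%:E)%E.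
  by apply: nneseries_ge0 => *; rewrite lee_fin powR_ge0.
rewrite /tail_mean ler_poweR2r ?invr_gt0 ?lee_fin ?powR_ge0//; last first.
  by rewrite mule_ge0// lee_fin.
rewrite lee_pdivlMl//.
apply: (@le_trans _ _ (\sum_(n <= k < n + n.+1) (a k `^ q)%:E)%E).
  rewrite sumEFin -EFinM lee_fin.
  have := sum_block_ge n n.+1 (nonincreasing_powR (ltW q0) ha).
  by rewrite addnS/= addnn.
by apply: nneseries_lim_ge => *; rewrite lee_fin powR_ge0.
Qed.

(** Bounding [a n.*2] and [a n.*2.+1] by [a n.*2] leaves twice the sum of the
    terms of even index, to which [tail_mean_ge] applies. *)
Lemma seq_sum_le q a : 0 < q -> nonincreasing_nonneg a ->
  (seq_sum a <= 2%:E * tail_sum q a)%E.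
Proof.
move=> q0 ha; have a0 n : 0 <= a n by case: ha.
apply: nneseries_le_bound => N; first by rewrite lee_fin.
apply: (@le_trans _ _ (\sum_(0 <= k < N.*2) (a k)%:E)%E).
  apply: lee_sum_nneg_natr => [n _ _|]; first by rewrite lee_fin.
  by rewrite -addnn leq_addr.
apply: (@le_trans _ _ (2%:E * \sum_(0 <= n < N) (a n.*2)%:E)%E).
  rewrite !sumEFin -EFinM lee_fin.
  elim: N => [|N ih]; first by rewrite !big_nil mulr0.
  rewrite doubleS !big_nat_recr//= mulrDr -addrA lerD//.
  by rewrite mulr_natl mulr2n lerD2l; case: ha.
rewrite lee_wpmul2l// (@le_trans _ _ (\sum_(0 <= n < N) tail_mean q a n)%E)//.
  by apply: lee_sum => n _; exact: tail_mean_ge.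
by apply: nneseries_lim_ge => *; exact: tail_mean_ge0.
Qed.

Lemma seq_sup_le q a : 0 < q -> nonincreasing_nonneg a ->
  (seq_sup a <= 2%:E * tail_sup q a)%E.
Proof.
move=> q0 ha; have a0 n : 0 <= a n by case: ha.
apply: ge_ereal_sup => _ [m _ <-].
apply: (@le_trans _ _ (2%:E * ((m./2).+1%:R%:E * tail_mean q a m./2))%E); last first.
  by rewrite lee_wpmul2l//; apply: ereal_sup_ubound; exists m./2.
apply: (@le_trans _ _ (2%:E * ((m./2).+1%:R%:E * (a m./2.*2)%:E))%E); last first.
  by rewrite !lee_wpmul2l//; exact: tail_mean_ge.
rewrite -!EFinM lee_fin mulrA ler_pM// -?natrM ?ler_nat.
  by rewrite mul2n doubleS -{1}(odd_double_half m); case: (odd m).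
by apply: nonincreasing_le => //; rewrite -{2}(odd_double_half m) leq_addl.
Qed.

(** Writing [s `^ q = s * s `^ (q - 1)], the second factor grows with [s]. *)
Lemma sum_powR_le (x : nat -> R) q N : 1 <= q -> (forall j, 0 <= x j) ->
  \sum_(0 <= j < N) x j `^ q <= (\sum_(0 <= j < N) x j) `^ q.
Proof.
move=> q1 x0; have q0 : 0 < q by exact: lt_le_trans q1.
elim: N => [|N ih]; first by rewrite !big_nil powR0 ?gt_eqF.
rewrite !big_nat_recr//=; set s := \sum_(0 <= j < N) x j in ih *.
apply: le_trans (lerD ih (lexx _)) _.
have s0 : 0 <= s by rewrite sumr_ge0.
have sx : 0 <= s + x N by rewrite addr_ge0.
rewrite -(mulr_powRB1 s0)// -(mulr_powRB1 (x0 N))// -(mulr_powRB1 sx)// mulrDl.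
by rewrite lerD// ler_wpM2l// ge0_ler_powR ?nnegrE ?subr_ge0// ?lerDl ?lerDr.
Qed.

Definition dyadic_ratio q : R := 2 `^ q^-1.

(** In the numbering from 1, the [j]-th summand is
    [2 ^ (j / q) * a_(2 ^ j * m)] with [m = n + 1]. *)
Definition dyadic_sum q a n : \bar R :=
  (\sum_(0 <= j <oo) (dyadic_ratio q ^+ j * a (2 ^ j * n.+1).-1)%:E)%E.

Lemma dyadic_term_ge0 q a n j : nonincreasing_nonneg a ->
  0 <= dyadic_ratio q ^+ j * a (2 ^ j * n.+1).-1.
Proof. by move=> [_ a0]; rewrite mulr_ge0// exprn_ge0// powR_ge0. Qed.

Lemma sum_dyadic_blocks a n J : nonincreasing_nonneg a ->
  \sum_(n <= k < (2 ^ J * n.+1).-1) a k <=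
  \sum_(0 <= j < J) (2 ^ j * n.+1)%:R * a (2 ^ j * n.+1).-1.
Proof.
move=> ha; elim: J => [|J ih]; first by rewrite mul1n big_geq// big_nil.
have pos : (0 < 2 ^ J * n.+1)%N by rewrite muln_gt0 expn_gt0.
have le1 : (n <= (2 ^ J * n.+1).-1)%N.
  by rewrite -ltnS prednK// leq_pmull// expn_gt0.
have E : (2 ^ J.+1 * n.+1).-1 = ((2 ^ J * n.+1).-1 + 2 ^ J * n.+1)%N.
  by rewrite expnS -mulnA mul2n -addnn -{1}(prednK pos).
rewrite E (big_cat_nat le1) ?leq_addr//= big_nat_recr//= lerD//.
exact: sum_block_le.
Qed.

(** Cutting the tail into dyadic blocks, the block of index [j] has
    [2 ^ j * n.+1] terms, each at most its first one; the root of exponent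
    [q^-1] is subadditive. *)
Lemma tail_mean_le_dyadic q a n : 1 < q -> nonincreasing_nonneg a ->
  (tail_mean q a n <= dyadic_sum q a n)%E.
Proof.
move=> q1 ha; have q0 : 0 < q by exact: lt_trans q1.
have a0 k : 0 <= a k by case: ha.
have x0 j := dyadic_term_ge0 q n j ha.
have d0 : (0 <= dyadic_sum q a n)%E by apply: nneseries_ge0 => *; rewrite lee_fin.
have dE : dyadic_sum q a n = poweR (poweR (dyadic_sum q a n) q) q^-1.
  by rewrite -poweRrM divff ?gt_eqF// poweRe1.
rewrite dE ler_poweR2r ?invr_gt0 ?poweR_ge0//; last first.
  rewrite mule_ge0// ?lee_fin//.
  by apply: nneseries_ge0 => *; rewrite lee_fin powR_ge0.
rewrite lee_pdivrMl//; apply: nneseries_le_bound => N.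
  by rewrite lee_fin powR_ge0.
apply: (@le_trans _ _ (\sum_(n <= k < (2 ^ N * n.+1).-1) (a k `^ q)%:E)%E).
  apply: lee_sum_nneg_natr => [k _ _|]; first by rewrite lee_fin powR_ge0.
  have p2 : (N < 2 ^ N)%N by exact: ltn_expl.
  rewrite -ltnS prednK ?muln_gt0 ?expn_gt0//.
  by rewrite (leq_trans p2)// leq_pmulr.
apply: (@le_trans _ _ (n.+1%:R * (\sum_(0 <= j < N)
    dyadic_ratio q ^+ j * a (2 ^ j * n.+1).-1) `^ q)%:E); last first.
  rewrite EFinM lee_wpmul2l// -poweR_EFin ler_poweR2r//; last first.
    by rewrite lee_fin sumr_ge0.
  rewrite -sumEFin.
  by apply: nneseries_lim_ge => *; rewrite lee_fin.
rewrite sumEFin lee_fin.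
have := sum_dyadic_blocks n N (nonincreasing_powR (ltW q0) ha) => /le_trans; apply.
apply: le_trans (ler_wpM2l _ (sum_powR_le N (ltW q1) x0)) => //.
rewrite mulr_sumr; apply: ler_sum => j _.
have rE : (dyadic_ratio q ^+ j) `^ q = 2 ^+ j.
  rewrite /dyadic_ratio -powR_mulrn ?powR_ge0// -!powRrM mulrCA mulVf ?gt_eqF//.
  by rewrite mulr1 powR_mulrn.
rewrite powRM ?exprn_ge0 ?powR_ge0// rE mulrA natrM natrX.
by rewrite [n.+1%:R * _]mulrC.
Qed.

(** The sum of the geometric series of ratio [2 `^ (q^-1 - 1)]. *)
Definition hardy_constant q : R := (1 - dyadic_ratio q / 2)^-1.

Lemma dyadic_ratio_lt2 q : 1 < q -> 0 < dyadic_ratio q / 2 < 1.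
Proof.
move=> q1; have q0 : 0 < q by exact: lt_trans q1.
have ln2 : 0 < ln (2 : R) by rewrite ln_gt0// ltr1n.
rewrite divr_gt0 ?powR_gt0//= ltr_pdivrMr// mul1r.
rewrite /dyadic_ratio /powR gt_eqF// -[ltRHS]lnK ?posrE// ltr_expR.
by rewrite gtr_pMl// invf_lt1.
Qed.

Lemma hardy_constant_gt0 q : 1 < q -> 0 < hardy_constant q.
Proof. by move=> /dyadic_ratio_lt2/andP[_ h]; rewrite invr_gt0 subr_gt0. Qed.

Lemma geometric_sum_le q (x : \bar R) N : 1 < q -> (0 <= x)%E ->
  (\sum_(0 <= j < N) ((dyadic_ratio q / 2) ^+ j)%:E * x
     <= (hardy_constant q)%:E * x)%E.
Proof.
move=> q1 x0; have /andP[z0 z1] := dyadic_ratio_lt2 q1.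
rewrite -ge0_sume_distrl => [|j _]; last by rewrite lee_fin exprn_ge0// ltW.
rewrite lee_wpmul2r// sumEFin lee_fin /hardy_constant.
have := @geometric_le_lim _ N 1 (dyadic_ratio q / 2) ler01 z0.
rewrite (ger0_norm (ltW z0)) mul1r => /(_ z1); apply: le_trans.
by rewrite /series/=; apply: ler_sum => j _; rewrite /geometric/= mul1r.
Qed.

(** In each block of [M] consecutive terms the last one is the smallest. *)
Lemma seq_sum_ge_subsequence M a : (0 < M)%N -> nonincreasing_nonneg a ->
  (\sum_(0 <= n <oo) (M%:R * a (M * n.+1).-1)%:E <= seq_sum a)%E.
Proof.
move=> M0 ha; have a0 n : 0 <= a n by case: ha.
apply: nneseries_le_bound => N; first by rewrite lee_fin mulr_ge0.
apply: (@le_trans _ _ (\sum_(0 <= k < M * N) (a k)%:E)%E); last first.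
  by apply: nneseries_lim_ge => *; rewrite lee_fin.
rewrite !sumEFin lee_fin; elim: N => [|N ih]; first by rewrite muln0 !big_nil.
rewrite big_nat_recr//= mulnS addnC.
rewrite (big_cat_nat (leq0n (M * N)) (leq_addr M _))/= lerD//.
exact: sum_block_ge.
Qed.

(** Exchanging the order of summation in the dyadic bound, the [j]-th series
    runs over every [2 ^ j]-th term of [a] and is at most [2 ^- j] times the
    sum of [a]; a convergent geometric series remains. *)
Lemma tail_sum_le q a : 1 < q -> nonincreasing_nonneg a ->
  (tail_sum q a <= (hardy_constant q)%:E * seq_sum a)%E.
Proof.
move=> q1 ha; have x0 n j := dyadic_term_ge0 q n j ha.
apply: (@le_trans _ _ (\sum_(0 <= n <oo) dyadic_sum q a n)%E).
  apply: lee_nneseries => [n _ _|n _]; first exact: tail_mean_ge0.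
  exact: tail_mean_le_dyadic.
rewrite nneseries_interchange => [|n j]; last by rewrite lee_fin.
apply: nneseries_le_bound => [j|N].
  by apply: nneseries_ge0 => *; rewrite lee_fin.
apply: le_trans (geometric_sum_le N q1 (seq_sum_ge0 ha)); apply: lee_sum => j _.
have z0 : 0 <= (dyadic_ratio q / 2) ^+ j by rewrite exprn_ge0// divr_ge0// powR_ge0.
apply: (@le_trans _ _ (((dyadic_ratio q / 2) ^+ j)%:E *
    \sum_(0 <= n <oo) ((2 ^ j)%:R * a (2 ^ j * n.+1).-1)%:E)%E); last first.
  by rewrite lee_wpmul2l ?lee_fin//; apply: seq_sum_ge_subsequence; rewrite ?expn_gt0.
rewrite -nneseriesZl => [|n _]; last by rewrite lee_fin mulr_ge0//; case: ha.
rewrite le_eqVlt; apply/orP; left; apply/eqP/eq_eseriesr => n _.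
by rewrite -EFinM mulrA natrX -exprMn divfK.
Qed.

(** Each term [2 ^ j * m * a_(2 ^ j * m)] is at most the supremum, so the same
    geometric series appears as for the sums. *)
Lemma tail_sup_le q a : 1 < q -> nonincreasing_nonneg a ->
  (tail_sup q a <= (hardy_constant q)%:E * seq_sup a)%E.
Proof.
move=> q1 ha; have x0 n j := dyadic_term_ge0 q n j ha.
apply: ge_ereal_sup => _ [n _ <-].
apply: (@le_trans _ _ (n.+1%:R%:E * dyadic_sum q a n)%E).
  by rewrite lee_wpmul2l//; exact: tail_mean_le_dyadic.
rewrite -nneseriesZl => [|j _]; last by rewrite lee_fin.
apply: nneseries_le_bound => [j|N]; first by rewrite mule_ge0// lee_fin.
apply: le_trans (geometric_sum_le N q1 (seq_sup_ge0 ha)); apply: lee_sum => j _.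
have z0 : 0 <= (dyadic_ratio q / 2) ^+ j by rewrite exprn_ge0// divr_ge0// powR_ge0.
apply: (@le_trans _ _ (((dyadic_ratio q / 2) ^+ j)%:E *
    ((2 ^ j * n.+1)%:R * a (2 ^ j * n.+1).-1)%:E)%E); last first.
  rewrite lee_wpmul2l ?lee_fin//; apply: ereal_sup_ubound.
  by exists (2 ^ j * n.+1).-1 => //; rewrite prednK// muln_gt0 expn_gt0.
rewrite -!EFinM lee_fin natrM natrX !mulrA -exprMn divfK//.
by rewrite [_ * dyadic_ratio q ^+ j]mulrC.
Qed.

(** All four functionals equal 1 on this sequence, which bounds every
    admissible constant below by 1. *)
Definition unit_seq (n : nat) : R := (n == 0)%:R.

Lemma unit_seq_nonincreasing : nonincreasing_nonneg unit_seq.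
Proof. by split=> n; rewrite /unit_seq//=. Qed.

Lemma tail_mean_unit_seq q n : 0 < q -> tail_mean q unit_seq n = (unit_seq n)%:E.
Proof.
move=> q0; rewrite /tail_mean; case: n => [|n]; last first.
  rewrite eseries0 ?mule0 ?poweR0r ?invr_eq0 ?gt_eqF// => -[|k]//= _ _.
  by rewrite powR0// gt_eqF.
rewrite invr1 mul1e nneseries_recl//; last by move=> *; rewrite lee_fin powR_ge0.
rewrite powR1 eseries0 ?adde0 ?poweR1r// => -[|k]//= _ _.
by rewrite powR0// gt_eqF.
Qed.

Lemma seq_sum_unit_seq : seq_sum unit_seq = 1%E.
Proof.
rewrite /seq_sum nneseries_recl//; last by move=> *; rewrite lee_fin.
by rewrite eseries0 ?adde0// => -[|k].
Qed.

Lemma tail_sum_unit_seq q : 0 < q -> tail_sum q unit_seq = 1%E.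
Proof.
move=> q0; rewrite -seq_sum_unit_seq; apply: eq_eseriesr => n _.
exact: tail_mean_unit_seq.
Qed.

Lemma seq_sup_unit_seq : seq_sup unit_seq = 1%E.
Proof.
apply/le_anti/andP; split.
  apply: ge_ereal_sup => _ [[|n] _ <-]; rewrite lee_fin ?mulr1//.
  by rewrite /unit_seq/= mulr0.
by apply: le_ereal_sup_tmp; exists 1%E => //; exists 0%N => //; rewrite mulr1.
Qed.

Lemma tail_sup_unit_seq q : 0 < q -> tail_sup q unit_seq = 1%E.
Proof.
move=> q0; rewrite -seq_sup_unit_seq; congr ereal_sup; apply/seteqP.
by split=> _ [n _ <-]; exists n => //; rewrite tail_mean_unit_seq.
Qed.

Lemma lower_c1_minimal q : 1 < q ->
  is_minimal_constant
    (upper_constants nonincreasing_nonneg seq_sum (tail_sum q)) (lower_c1 q).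
Proof.
move=> q1; have q0 : 0 < q by exact: lt_trans q1.
rewrite /lower_c1 minimal_constant_lower.
apply: (minimal_constantP _ unit_seq_nonincreasing seq_sum_unit_seq _
  (hardy_constant_gt0 q1)).
- exact: seq_sum_ge0.
- by rewrite tail_sum_unit_seq.
- by move=> a; exact: tail_sum_le.
Qed.

Lemma upper_C1_minimal q : 1 < q ->
  is_minimal_constant
    (upper_constants nonincreasing_nonneg (tail_sum q) seq_sum) (upper_C1 q).
Proof.
move=> q1; have q0 : 0 < q by exact: lt_trans q1.
apply: (minimal_constantP _ unit_seq_nonincreasing (tail_sum_unit_seq q0) _
  (ltr0n _ 2)) => //.
- by move=> *; exact: tail_sum_ge0.
- by rewrite seq_sum_unit_seq.
- by move=> a; exact: seq_sum_le.
Qed.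

Lemma lower_c1oo_minimal q : 1 < q ->
  is_minimal_constant
    (upper_constants nonincreasing_nonneg seq_sup (tail_sup q)) (lower_c1oo q).
Proof.
move=> q1; have q0 : 0 < q by exact: lt_trans q1.
rewrite /lower_c1oo minimal_constant_lower.
apply: (minimal_constantP _ unit_seq_nonincreasing seq_sup_unit_seq _
  (hardy_constant_gt0 q1)).
- exact: seq_sup_ge0.
- by rewrite tail_sup_unit_seq.
- by move=> a; exact: tail_sup_le.
Qed.

Lemma upper_C1oo_minimal q : 1 < q ->
  is_minimal_constant
    (upper_constants nonincreasing_nonneg (tail_sup q) seq_sup) (upper_C1oo q).
Proof.
move=> q1; have q0 : 0 < q by exact: lt_trans q1.
apply: (minimal_constantP _ unit_seq_nonincreasing (tail_sup_unit_seq q0) _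
  (ltr0n _ 2)) => //.
- by move=> *; exact: tail_sup_ge0.
- by rewrite seq_sup_unit_seq.
- by move=> a; exact: seq_sup_le.
Qed.

End SequenceInequalities.

(** * Non-increasing rearrangements *)

Section Rearrangement.
Context {R : realType}.
Implicit Types (a x : nat -> R) (s : nat -> nat).

(** For [t >= 0] the terms exceeding [t] occupy an initial segment, so there
    are at most [n] of them exactly when [a n <= t]. *)
Lemma rearrangement_nonincreasing a :
  nonincreasing_nonneg a -> rearrangement a = a.
Proof.
move=> ha; have a0 n : 0 <= a n by case: ha.
apply/funext => n; rewrite /rearrangement.
set S := [set _ | _].
have inS t : S t -> a n <= t.
  move=> [t0 hcard]; rewrite leNgt; apply/negP => tan.
  suff : (`I_n.+1 #<= `I_n)%card by rewrite card_le_II ltnn.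
  apply: card_le_trans hcard; apply: subset_card_le => k /= kn.
  by rewrite ger0_norm//; apply: (lt_le_trans tan); exact: nonincreasing_le.
have San : S (a n).
  split=> //; apply: subset_card_le => k /=; rewrite ger0_norm// => ank.
  by rewrite ltnNge; apply/negP => /(nonincreasing_le ha); rewrite leNgt ank.
apply/le_anti/andP; split; first by apply: ge_inf => //; exists (a n) => t /inS.
by apply: lb_le_inf; [exists (a n) | move=> t /inS].
Qed.

Lemma eq_rearrangement x y :
  (forall t, 0 <= t -> [set k | t < `|x k|] #= [set k | t < `|y k|])%card ->
  rearrangement x = rearrangement y.
Proof.
move=> xy; apply/funext => n; congr inf; apply/seteqP.
by split=> t [t0 h]; split => //; move: h; rewrite (card_le_eql (xy _ t0)).
Qed.

(** [s] lists indices in an order of non-increasing absolute value.  When [x]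
    tends to 0 every index outside the range of [s] carries a zero term; there
    may be such indices, when infinitely many terms are nonzero and some
    vanish. *)
Definition decreasing_enum x s :=
  injective s /\ forall n k, k \notin mkseq s n -> `|x k| <= `|x (s n)|.

(** If some term off [L] is nonzero, only finitely many terms are at least as
    large, and a maximum over finitely many indices is taken. *)
Lemma max_norm_avoiding x (L : seq nat) : x @ \oo --> (0 : R) ->
  exists2 m, m \notin L & forall k, k \notin L -> `|x k| <= `|x m|.
Proof.
move=> x0; have [[k1 k1L xk1]|] :=
    pselect (exists2 k, k \notin L & 0 < `|x k|); last first.
  move=> all0; exists (\max_(i <- L) i).+1.
    apply/negP => h; have := @leq_bigmax_seq _ L xpredT id _ h isT.
    by rewrite ltnn.
  move=> k kL; suff -> : `|x k| = 0 by [].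
  by apply/eqP; rewrite eq_le normr_ge0 andbT leNgt; apply/negP => ?; apply: all0; exists k.
have /cvgr0Pnorm_lt/(_ _ xk1)[N _ small] := x0.
have k1N : (k1 < N)%N.
  by rewrite ltnNge; apply/negP => /small/=; rewrite ltxx.
case: (arg_maxP (fun i : 'I_N => `|x i|) (i0 := Ordinal k1N)
  (P := fun i : 'I_N => val i \notin L) k1L) => m mL mmax.
exists (val m) => // k kL; have [kN|Nk] := ltnP k N.
  exact: (mmax (Ordinal kN)).
exact: le_trans (ltW (small _ Nk)) (mmax (Ordinal k1N) k1L).
Qed.

(** Greedy choice: the next index carries a largest term among the indices not
    listed before. *)
Lemma decreasing_enum_exists x : x @ \oo --> (0 : R) ->
  exists s, decreasing_enum x s.
Proof.
move=> /max_norm_avoiding avoid.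
have /choice[pick pickP] (L : seq nat) : exists m, m \notin L /\
    forall k, k \notin L -> `|x k| <= `|x m|.
  by have [m ? ?] := avoid L; exists m.
pose fix prefix n := if n is k.+1 then rcons (prefix k) (pick (prefix k)) else [::].
pose s n := pick (prefix n).
have prefixE n : prefix n = mkseq s n by elim: n => // n ih; rewrite mkseqS -ih.
have fresh m n : (m < n)%N -> s m != s n.
  move=> mn; have [+ _] := pickP (prefix n); apply: contraNneq => smn.
  by rewrite -/(s n) -smn prefixE; apply: map_f; rewrite mem_iota.
exists s; split=> [m n smn|n k]; last by rewrite -prefixE; exact: (pickP _).2.
by case: (ltngtP m n) => // /fresh; rewrite smn eqxx.
Qed.

Section Enum.
Variables (x : nat -> R) (s : nat -> nat).
Hypotheses (x0 : x @ \oo --> (0 : R)) (xs : decreasing_enum x s).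

Lemma decreasing_enum_uniq n : uniq (mkseq s n).
Proof. by rewrite map_inj_uniq ?iota_uniq; case: xs. Qed.

Lemma decreasing_enum_nonincreasing :
  nonincreasing_nonneg (fun n => `|x (s n)|).
Proof.
split=> n //=; apply: xs.2; apply/mapP => -[m].
by rewrite mem_iota add0n => /andP[_ mn] /xs.1 E; rewrite -E ltnNge leqnSn in mn.
Qed.

(** The term at an index that is never listed is dominated by all the
    [x (s n)], among which there are arbitrarily small ones because an
    injective [s] leaves every bounded set of indices. *)
Lemma decreasing_enum_support k : ~ range s k -> x k = 0.
Proof.
move=> nk; apply/eqP; rewrite -normr_eq0 eq_le normr_ge0 andbT leNgt.
apply/negP => xk; have /cvgr0Pnorm_lt/(_ _ xk)[N _ small] := x0.
have [n Nn] : exists n, (N <= s n)%N.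
  apply: contrapT => noN.
  have sub : {subset mkseq s N.+1 <= iota 0 N}.
    move=> _ /mapP[m _ ->]; rewrite mem_iota add0n leq0n ltnNge.
    by apply/negP => h; apply: noN; exists m.
  have := uniq_leq_size (decreasing_enum_uniq N.+1) sub.
  by rewrite size_mkseq size_iota ltnn.
have := small _ Nn; rewrite /= ltNge xs.2//.
by apply/mapP => -[m _ km]; apply: nk; exists m.
Qed.

Lemma rearrangementE : rearrangement x = (fun n => `|x (s n)|).
Proof.
rewrite -[RHS]rearrangement_nonincreasing; last exact: decreasing_enum_nonincreasing.
apply: eq_rearrangement => t t0.
have -> : [set k | t < `|x k|] = s @` [set n | t < `| `|x (s n)| |].
  apply/seteqP; split=> [k tk|_ [n tn <-]] /=; last by move: tn; rewrite /= normr_id.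
  have [[n _ snk]|nk] := pselect (range s k).
    by exists n => //=; rewrite normr_id snk.
  by move: tk; rewrite /= (decreasing_enum_support nk) normr0 ltNge t0.
by apply: inj_card_eq => m n _ _; exact: xs.1.
Qed.

Lemma decreasing_enum_sum :
  (\sum_(0 <= n <oo) (x (s n) ^+ 2)%:E = \sum_(0 <= k <oo) (x k ^+ 2)%:E)%E.
Proof.
rewrite !nneseries_esumT; try by move=> *; rewrite lee_fin sqr_ge0.
rewrite -(esum_image _ _ (fun k => (x k ^+ 2)%:E)); last first.
  by move=> m n _ _; exact: xs.1.
rewrite esum_mkcond; apply: eq_esum => k _.
case: ifPn => //; rewrite notin_setE => nk.
by rewrite (decreasing_enum_support nk) expr0n.
Qed.

(** With [t] the largest square off the first [n] listed indices, a sum of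
    terms [x k ^+ 2 - t] can only grow when negative terms are dropped, and the
    positive ones all occur among these [n] indices. *)
Lemma sum_sqr_le_enum (L : seq nat) n : uniq L -> (size L <= n)%N ->
  \sum_(k <- L) x k ^+ 2 <= \sum_(k <- mkseq s n) x k ^+ 2.
Proof.
move=> uL sL; set t := `|x (s n)| ^+ 2; set S := mkseq s n.
have big_t k : k \in S -> t <= x k ^+ 2.
  move=> /mapP[m]; rewrite mem_iota add0n => /andP[_ mn] ->.
  rewrite -[leRHS]real_normK ?num_real// ler_sqr ?nnegrE//.
  exact: (nonincreasing_le decreasing_enum_nonincreasing (ltnW mn)).
have small_t k : k \notin S -> x k ^+ 2 <= t.
  by move=> kS; rewrite -[leLHS]real_normK ?num_real// ler_sqr ?nnegrE// xs.2.
have E (M : seq nat) :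
    \sum_(k <- M) x k ^+ 2 = \sum_(k <- M) (x k ^+ 2 - t) + (size M)%:R * t.
  by rewrite sumrB big_const_seq count_predT iter_addr_0 mulr_natl subrK.
rewrite !E lerD//; last first.
  by rewrite ler_wpM2r ?exprn_ge0// size_mkseq ler_nat.
rewrite (bigID (mem S))/= -[leRHS]addr0 lerD//; last first.
  by rewrite big_seq_cond sumr_le0// => k /andP[_ kS]; rewrite subr_le0 small_t.
rewrite -big_filter [leRHS](bigID (mem L))/= -[leLHS]addr0 lerD//; last first.
  rewrite big_seq_cond sumr_ge0// => k /andP[kS _].
  by rewrite subr_ge0 big_t.
rewrite -[leRHS]big_filter le_eqVlt; apply/orP; left; apply/eqP/perm_big.
apply: uniq_perm; rewrite ?filter_uniq ?decreasing_enum_uniq// => k.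
by rewrite !mem_filter andbC.
Qed.

End Enum.
End Rearrangement.

(** * Best approximation in a Hilbert space *)

Section Hilbert.
Context {R : realType} {H : completeNormedModType R}.
Variables (dot : {dot H for (@idfun R)}) (e : nat -> H).
Hypotheses (hdot : norm_of_inner_product dot) (he : orthonormal_basis dot e).

Notation coef f := (coefficients dot e f).

Let dotC (u v : H) : dot u v = dot v u.
Proof. by have := hermC dot u v; rewrite expr0 mul1r. Qed.

Let dotBl (u v w : H) : dot (u - v) w = dot u w - dot v w.
Proof. exact: linearBl. Qed.

Let dotZl a (u v : H) : dot (a *: u) v = a * dot u v.
Proof. exact: linearZl_LR. Qed.

Let dot_suml (L : seq nat) (u : nat -> H) v :
  dot (\sum_(k <- L) u k) v = \sum_(k <- L) dot (u k) v.
Proof. exact: linear_sumlz. Qed.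

Lemma coef_sum (L : seq nat) lam j : uniq L ->
  dot (\sum_(k <- L) lam k *: e k) (e j) = if j \in L then lam j else 0.
Proof.
move=> uL; rewrite dot_suml.
under eq_bigr do rewrite dotZl he.1.
case: ifPn => jL.
  rewrite (bigD1_seq j)//= eqxx mulr1 big1 ?addr0// => k kj.
  by rewrite (negPf kj) mulr0.
rewrite big_seq big1// => k kL; case: eqP => [kj|_]; last by rewrite mulr0.
by rewrite -kj kL in jL.
Qed.

(** Pythagoras: the coefficients of [f] are the best choice of [lam]. *)
Lemma sqr_norm_sub_sum (f : H) (L : seq nat) lam : uniq L ->
  `|f - \sum_(k <- L) lam k *: e k| ^+ 2 =
  `|f| ^+ 2 - \sum_(k <- L) coef f k ^+ 2 + \sum_(k <- L) (coef f k - lam k) ^+ 2.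
Proof.
move=> uL; set g := \sum_(k <- L) _.
have gE u : dot g u = \sum_(k <- L) lam k * coef u k.
  by rewrite dot_suml; apply: eq_bigr => k _; rewrite dotZl [dot (e k) u]dotC.
have gg : dot g g = \sum_(k <- L) lam k ^+ 2.
  rewrite gE big_seq [RHS]big_seq; apply: eq_bigr => k kL.
  by rewrite /coefficients coef_sum// kL expr2.
have -> : \sum_(k <- L) (coef f k - lam k) ^+ 2 = \sum_(k <- L) coef f k ^+ 2 -
    2 * (\sum_(k <- L) lam k * coef f k) + \sum_(k <- L) lam k ^+ 2.
  rewrite mulr_sumr -sumrB -big_split/=; apply: eq_bigr => k _; ring.
by rewrite hdot dotBl [dot f _]dotC [dot g (f - g)]dotC !dotBl -hdot [dot f g]dotC gg gE; ring.
Qed.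

Lemma sqr_norm_sub_projection (f : H) (L : seq nat) : uniq L ->
  `|f - \sum_(k <- L) coef f k *: e k| ^+ 2 =
  `|f| ^+ 2 - \sum_(k <- L) coef f k ^+ 2.
Proof.
move=> uL; rewrite sqr_norm_sub_sum// [X in _ + X]big1 ?addr0// => k _.
by rewrite subrr expr0n.
Qed.

Lemma bessel (f : H) (L : seq nat) : uniq L ->
  \sum_(k <- L) coef f k ^+ 2 <= `|f| ^+ 2.
Proof.
by move=> uL; rewrite -subr_ge0 -sqr_norm_sub_projection// sqr_ge0.
Qed.

Lemma norm_sum_sqr (L : seq nat) lam : uniq L ->
  `|\sum_(k <- L) lam k *: e k| ^+ 2 = \sum_(k <- L) lam k ^+ 2.
Proof.
move=> uL; have := sqr_norm_sub_sum 0 lam uL.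
have c0 k : coef 0 k = 0 by exact: linear0l.
rewrite sub0r normrN normr0 expr0n => ->.
rewrite big1 ?subr0 ?add0r => [|k _]; last by rewrite c0 expr0n.
by apply: eq_bigr => k _; rewrite c0 sub0r sqrrN.
Qed.

Lemma sqr_norm_sub_sum_ge (f : H) (L : seq nat) lam : uniq L ->
  `|f| ^+ 2 - \sum_(k <- L) coef f k ^+ 2 <= `|f - \sum_(k <- L) lam k *: e k| ^+ 2.
Proof.
by move=> uL; rewrite sqr_norm_sub_sum// lerDl sumr_ge0// => k _; rewrite sqr_ge0.
Qed.

(** By density [f] is within [Num.sqrt eps] of a finite combination of basis
    vectors, and projecting on the same vectors does at least as well. *)
Lemma parseval (f : H) :
  (\sum_(0 <= k <oo) (coef f k ^+ 2)%:E = (`|f| ^+ 2)%:E)%E.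
Proof.
apply/le_anti/andP; split.
  apply: lime_le; first by apply: is_cvg_nneseries => *; rewrite lee_fin sqr_ge0.
  by apply: nearW => N; rewrite sumEFin lee_fin bessel// iota_uniq.
apply/lee_addgt0Pr => eps eps0.
have [g []] : (ball f (Num.sqrt eps) `&` \bigcup_n sparse e n) !=set0.
  apply: he.2; last exact: ball_open.
  by exists f; apply: ballxx; rewrite sqrtr_gt0.
rewrite -ball_normE/= => fg [n _ [L [lam [_ gE]]]].
have uL := fset_uniq L.
have le1 : `|f| ^+ 2 <= \sum_(k <- L) coef f k ^+ 2 + eps.
  rewrite -lerBlDl; apply: le_trans (sqr_norm_sub_sum_ge f lam uL) _.
  rewrite -gE -(sqr_sqrtr (ltW eps0)) ler_sqr ?nnegrE ?sqrtr_ge0//.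
  exact: ltW.
apply: (@le_trans _ _ (\sum_(k <- L) coef f k ^+ 2 + eps)%:E) => //.
rewrite EFinD leeD2r// -sumEFin.
by apply: lee_sum_fset_lim => k _; rewrite lee_fin sqr_ge0.
Qed.

Lemma coefficients_cvg0 (f : H) : coef f @ \oo --> (0 : R).
Proof.
have sq0 : (fun k => coef f k ^+ 2) @ \oo --> (0 : R).
  apply: cvg_series_cvg_0; apply: nnseries_is_cvg => [k|]; first exact: sqr_ge0.
  by rewrite parseval ltry.
apply/cvgr0Pnorm_lt => eps eps0.
have /cvgr0Pnorm_lt/(_ _ (exprn_gt0 2 eps0)) := sq0.
apply: filterS => k /=; rewrite normrX ltr_sqr// ?nnegrE ltW//.
Qed.

(** Riesz--Fischer: the partial sums of [\sum_k x k *: e k] are Cauchy by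
    Pythagoras. *)
Lemma coefficients_surjective (x : nat -> R) :
  (\sum_(0 <= k <oo) (x k ^+ 2)%:E < +oo)%E -> exists f : H, coef f = x.
Proof.
move=> xfin.
have : cvgn (series (fun k => x k ^+ 2)).
  by apply: nnseries_is_cvg => [k|//]; exact: sqr_ge0.
move=> /cauchy_cvgP/cauchy_seriesP xC.
have : cvgn (series (fun k => x k *: e k)).
  apply/cauchy_cvgP/cauchy_seriesP => eps eps0.
  have := xC _ (exprn_gt0 2 eps0); apply: filterS => -[m n] /=.
  rewrite ger0_norm; last by apply: sumr_ge0 => *; exact: sqr_ge0.
  by rewrite -norm_sum_sqr ?iota_uniq// ltr_sqr ?nnegrE ?(ltW eps0).
move=> /cvg_ex[f /cvgrPdist_lt fcvg]; exists f; apply/funext => j.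
apply/eqP; rewrite -subr_eq0 -normr_eq0 eq_le normr_ge0 andbT.
apply/ler_addgt0Pr => eps /fcvg[N _ fN]; rewrite add0r.
have jn : (j < maxn N j.+1)%N by rewrite leq_max leqnn orbT.
(* The partial sum must be close to [f] and contain the term of index [j]. *)
have := fN (maxn N j.+1) (leq_maxl _ _) => /=.
set n := maxn _ _ in jn *; set g := series _ n => fg.
have gj : coef g j = x j.
  by rewrite /coefficients coef_sum ?iota_uniq// mem_index_iota jn.
rewrite -gj -dotBl; apply: le_trans (ltW fg).
rewrite -ler_sqr ?nnegrE// real_normK ?num_real//.
by have := @bessel (f - g) [:: j] isT; rewrite big_seq1.
Qed.

(** The best approximation by [n] basis vectors keeps the [n] largest
    coefficients. *)
Lemma approx_errorE (f : H) s n : decreasing_enum (coef f) s ->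
  approx_error e n.+1 f ^+ 2 = `|f| ^+ 2 - \sum_(k <- mkseq s n) coef f k ^+ 2.
Proof.
move=> fs; have uS := decreasing_enum_uniq fs n.
set d := _ - _; have d0 : 0 <= d by rewrite subr_ge0 bessel.
suff -> : approx_error e n.+1 f = Num.sqrt d by rewrite sqr_sqrtr.
have lb g : sparse e n.+1 g -> Num.sqrt d <= `|f - g|.
  move=> [L [lam [Ln ->]]]; rewrite -[leRHS]ger0_norm// -sqrtr_sqr ler_sqrt ?sqr_ge0//.
  apply: le_trans (sqr_norm_sub_sum_ge f lam (fset_uniq L)).
  by rewrite lerD2l lerN2 (sum_sqr_le_enum fs)// ?fset_uniq.
apply/le_anti/andP; split.
  apply: ge_inf; first by exists (Num.sqrt d) => _ [g /lb ? <-].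
  exists (\sum_(k <- [fset k in mkseq s n]%fset) coef f k *: e k).
    exists [fset k in mkseq s n]%fset, (coef f); split=> //.
    by rewrite card_fseq undup_id// size_mkseq.
  have pS : perm_eq [fset k in mkseq s n]%fset (mkseq s n).
    by rewrite uniq_perm// => k; rewrite inE.
  rewrite (perm_big _ pS)/=.
  by rewrite -[LHS]ger0_norm// -sqrtr_sqr sqr_norm_sub_projection.
apply: lb_le_inf => [|_ [g /lb ? <-]//].
exists `|f - 0|; exists 0 => //; exists fset0, (fun=> 0).
by rewrite cardfs0 big_seq_fset0.
Qed.

Lemma sqr_approx_error (f : H) n :
  ((approx_error e n.+1 f ^+ 2)%:E =
   \sum_(n <= k <oo) (rearrangement (coef f) k ^+ 2)%:E)%E.
Proof.
have f0 := coefficients_cvg0 f.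
have [s fs] := decreasing_enum_exists f0.
rewrite (approx_errorE n fs) (rearrangementE f0 fs).
under eq_eseriesr do rewrite real_normK ?num_real//.
have := decreasing_enum_sum f0 fs; rewrite parseval.
rewrite (nneseries_split 0 n) => [|k _]; last by rewrite lee_fin sqr_ge0.
rewrite add0n big_map sumEFin EFinB => <-.
by rewrite addeAC /index_iota subn0 subee ?add0e.
Qed.

End Hilbert.

(** * From functions to sequences *)

(** A positive power is an increasing bijection of [[0, +oo]]. *)
Lemma ereal_sup_poweR {R : realType} (F : nat -> \bar R) (theta : R) :
  0 < theta -> (forall n, 0 <= F n)%E ->
  ereal_sup [set poweR (F n) theta | n in [set: nat]] =
  poweR (ereal_sup [set F n | n in [set: nat]]) theta.
Proof.
move=> t0 F0; set X := ereal_sup _; set Y := ereal_sup _.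
have Y0 : (0 <= Y)%E by apply: le_ereal_sup_tmp; exists (F 0%N) => //; exists 0%N.
have X0 : (0 <= X)%E.
  apply: le_ereal_sup_tmp; exists (poweR (F 0%N) theta); last exact: poweR_ge0.
  by exists 0%N.
apply/le_anti/andP; split.
  apply: ge_ereal_sup => _ [n _ <-]; rewrite ler_poweR2r//.
  by apply: ereal_sup_ubound; exists n.
have -> : X = poweR (poweR X theta^-1) theta.
  by rewrite -poweRrM mulVf ?gt_eqF// poweRe1.
rewrite ler_poweR2r ?poweR_ge0//; apply: ge_ereal_sup => _ [n _ <-].
have -> : F n = poweR (poweR (F n) theta) theta^-1.
  by rewrite -poweRrM divff ?gt_eqF// poweRe1.
rewrite ler_poweR2r ?invr_gt0 ?poweR_ge0//.
by apply: ereal_sup_ubound; exists n.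
Qed.

Lemma pinfty_of_le {R : realType} (K : R) (x : \bar R) : (0 <= x)%E ->
  (+oo <= K%:E * x)%E -> x = +oo%E.
Proof.
move=> x0; rewrite leye_eq => /eqP Kx; apply/eqP; rewrite -leye_eq leNgt.
apply/negP => xoo; have xfin : x \is a fin_num by rewrite ge0_fin_numE.
by move: Kx; rewrite -(fineK xfin).
Qed.

Section Profile.
Context {R : realType} {H : completeNormedModType R}.
Variables (dot : {dot H for (@idfun R)}) (e : nat -> H).
Hypotheses (hdot : norm_of_inner_product dot) (he : orthonormal_basis dot e).
Variables (alpha : R) (alpha_gt0 : 0 < alpha).

Let theta : R := alpha + 2^-1.
Let tau : R := theta^-1.
Let q : R := 2 * alpha + 1.

Let theta_gt0 : 0 < theta. Proof. by rewrite addr_gt0. Qed.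
Let tau_gt0 : 0 < tau. Proof. by rewrite invr_gt0. Qed.
Let qE : q = 2 * theta. Proof. by rewrite /q /theta mulrDr divff. Qed.
Let q_gt1 : 1 < q. Proof. by rewrite ltrDr mulr_gt0. Qed.
Let q_gt0 : 0 < q. Proof. exact: lt_trans q_gt1. Qed.

Definition profile (f : H) (k : nat) : R :=
  rearrangement (coefficients dot e f) k `^ tau.

Lemma rearrangement_coef_nonincreasing f :
  nonincreasing_nonneg (rearrangement (coefficients dot e f)).
Proof.
have f0 := coefficients_cvg0 hdot he f.
have [s fs] := decreasing_enum_exists f0.
by rewrite (rearrangementE f0 fs); exact: decreasing_enum_nonincreasing fs.
Qed.

Lemma profile_nonincreasing f : nonincreasing_nonneg (profile f).
Proof.
exact: nonincreasing_powR (ltW tau_gt0) (rearrangement_coef_nonincreasing f).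
Qed.

Lemma approx_error_ge0 n f : 0 <= approx_error e n.+1 f.
Proof.
apply: lb_le_inf => [|_ [g _ <-]//].
exists `|f - 0|; exists 0 => //; exists fset0, (fun=> 0).
by rewrite cardfs0 big_seq_fset0.
Qed.

Lemma tail_mean_profile f n : tail_mean q (profile f) n =
  ((n.+1%:R^-1 * approx_error e n.+1 f ^+ 2) `^ q^-1)%:E.
Proof.
rewrite -poweR_EFin EFinM (sqr_approx_error hdot he) /tail_mean.
congr (poweR (_ * _)%E _); apply: eq_eseriesr => k _; congr EFin.
rewrite /profile -powRrM qE mulrCA mulVf ?gt_eqF// mulr1 powR_mulrn//.
by case: (rearrangement_coef_nonincreasing f).
Qed.

(** Uses [theta / q = 1 / 2] and [theta - 1 / 2 = alpha]. *)
Let weighted_error (N E : R) : 0 < N -> 0 <= E ->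
  N `^ alpha * E = (N * (N^-1 * E ^+ 2) `^ q^-1) `^ theta.
Proof.
move=> N0 E0.
have tq : q^-1 * theta = 2^-1 by rewrite qE invfM -mulrA mulVf ?gt_eqF// mulr1.
rewrite [RHS]powRM ?powR_ge0 ?(ltW N0)// -powRrM tq.
rewrite powRM ?invr_ge0 ?(ltW N0) ?sqr_ge0// !powR12_sqrt ?sqr_ge0 ?invr_ge0 ?(ltW N0)//.
rewrite sqrtr_sqr ger0_norm// mulrA; congr (_ * _).
rewrite -powR12_sqrt ?invr_ge0 ?(ltW N0)// -powR_inv1 ?(ltW N0)// -powRrM mulN1r.
by rewrite -powRD ?addrK// (gt_eqF N0) implybT.
Qed.

Lemma approx_qnorm_tau f :
  approx_qnorm e alpha tau%:E f = poweR (tail_sum q (profile f)) theta.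
Proof.
rewrite /approx_qnorm /weighted_qnorm invrK; congr poweR.
apply: eq_eseriesr => n _; rewrite tail_mean_profile; congr EFin.
rewrite weighted_error ?approx_error_ge0// -powRrM divff ?gt_eqF// powRr1.
  by rewrite mulrAC divff ?gt_eqF// mul1r.
by rewrite mulr_ge0// powR_ge0.
Qed.

Lemma approx_qnorm_oo f :
  approx_qnorm e alpha +oo f = poweR (tail_sup q (profile f)) theta.
Proof.
rewrite -ereal_sup_poweR//; last by move=> n; rewrite mule_ge0 ?tail_mean_ge0.
congr ereal_sup; apply: eq_imagel => n _.
by rewrite tail_mean_profile -EFinM poweR_EFin weighted_error ?approx_error_ge0.
Qed.

Let weighted_coef (N b : R) : 0 <= N -> 0 <= b ->
  N `^ theta * b = (N * b `^ tau) `^ theta.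
Proof.
move=> N0 b0; rewrite [RHS]powRM ?powR_ge0// -powRrM mulVf ?gt_eqF// powRr1//.
Qed.

Lemma coef_qnorm_tau f :
  coef_qnorm dot e tau%:E tau%:E f = poweR (seq_sum (profile f)) theta.
Proof.
have [_ b0] := rearrangement_coef_nonincreasing f.
rewrite /coef_qnorm /lorentz_qnorm /weighted_qnorm fine_invr invrK; congr poweR.
apply: eq_eseriesr => n _; congr EFin.
rewrite weighted_coef// -powRrM divff ?gt_eqF// powRr1.
  by rewrite mulrAC divff ?gt_eqF// mul1r.
by rewrite mulr_ge0// powR_ge0.
Qed.

Lemma coef_qnorm_oo f :
  coef_qnorm dot e tau%:E +oo f = poweR (seq_sup (profile f)) theta.
Proof.
have [_ b0] := rearrangement_coef_nonincreasing f.
have [_ a0] := profile_nonincreasing f.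
rewrite -ereal_sup_poweR//; last by move=> n; rewrite lee_fin mulr_ge0.
rewrite /coef_qnorm /lorentz_qnorm fine_invr invrK.
congr ereal_sup; apply: eq_imagel => n _.
by apply: (congr1 EFin); exact: weighted_coef.
Qed.

(** The coefficients [a k `^ theta] are square summable because
    [2 * theta = q], and they are their own rearrangement. *)
Lemma profile_surjective a : nonincreasing_nonneg a ->
  (\sum_(0 <= k <oo) (a k `^ q)%:E < +oo)%E -> exists f, profile f = a.
Proof.
move=> ha afin; have [_ a0] := ha.
have [|f fE] := coefficients_surjective hdot he (x := fun k => a k `^ theta).
  rewrite (_ : (\sum_(0 <= k <oo) _ = \sum_(0 <= k <oo) (a k `^ q)%:E)%E)//.
  apply: eq_eseriesr => k _; congr EFin.
  by rewrite -powR_mulrn ?powR_ge0// -powRrM qE mulrC.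
exists f; apply/funext => k; rewrite /profile fE.
rewrite rearrangement_nonincreasing; last exact: nonincreasing_powR (ltW theta_gt0) ha.
by rewrite -powRrM divff ?gt_eqF// powRr1.
Qed.

Lemma tail_mean0_pinfty a :
  ~ (\sum_(0 <= k <oo) (a k `^ q)%:E < +oo)%E -> tail_mean q a 0 = +oo%E.
Proof.
move=> /negP; rewrite -leNgt leye_eq => /eqP aoo.
by rewrite /tail_mean aoo invr1 mul1e poweRyr// invr_eq0 gt_eqF.
Qed.

(** [S] and [T] stand for the two sides of a sequence inequality.  If [a] is
    not a profile, the first tail mean is already infinite, hence so is [T], and
    the Hardy-type inequality carries this over to [S]. *)
Lemma profile_or_pinfty (K : R) (S T : \bar R) a : nonincreasing_nonneg a ->
  (0 <= S)%E -> (tail_mean q a 0 <= T)%E -> (T <= K%:E * S)%E ->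
  (S = +oo /\ T = +oo)%E \/ exists f, profile f = a.
Proof.
move=> ha S0 aT TS.
have [afin|/tail_mean0_pinfty ainf] :=
    pselect (\sum_(0 <= k <oo) (a k `^ q)%:E < +oo)%E.
  by right; exact: profile_surjective.
have toy : T = +oo%E by apply/eqP; rewrite -leye_eq -ainf.
by left; split=> //; apply: (@pinfty_of_le _ K) => //; rewrite -toy.
Qed.

Lemma profile_or_pinfty_sum a : nonincreasing_nonneg a ->
  (seq_sum a = +oo /\ tail_sum q a = +oo)%E \/ exists f, profile f = a.
Proof.
move=> ha; apply: (profile_or_pinfty ha (seq_sum_ge0 ha) _ (tail_sum_le q_gt1 ha)).
have := @nneseries_lim_ge _ (tail_mean q a) xpredT 0 1 (fun n _ _ => tail_mean_ge0 q a n).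
by rewrite big_nat1.
Qed.

Lemma profile_or_pinfty_sup a : nonincreasing_nonneg a ->
  (seq_sup a = +oo /\ tail_sup q a = +oo)%E \/ exists f, profile f = a.
Proof.
move=> ha; apply: (profile_or_pinfty ha (seq_sup_ge0 ha) _ (tail_sup_le q_gt1 ha)).
by apply: ereal_sup_ubound; exists 0%N => //; rewrite mul1e.
Qed.

Lemma is_minimal_constant_profile (A B : (nat -> R) -> \bar R)
    (A' B' : H -> \bar R) (m : R) :
  (forall a, nonincreasing_nonneg a -> 0 <= A a)%E ->
  (forall a, nonincreasing_nonneg a -> 0 <= B a)%E ->
  (forall f, A' f = poweR (A (profile f)) theta) ->
  (forall f, B' f = poweR (B (profile f)) theta) ->
  (forall a, nonincreasing_nonneg a ->
     (A a = +oo /\ B a = +oo)%E \/ exists f, profile f = a) ->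
  is_minimal_constant (upper_constants nonincreasing_nonneg A B) m ->
  forall c, is_minimal_constant (upper_constants setT A' B') c <-> c = m `^ theta.
Proof.
move=> A0 B0 A'E B'E cover; apply: is_minimal_constant_powR => //.
  move=> f _; exists (profile f).
  by split; [exact: profile_nonincreasing | exact: A'E | exact: B'E].
move=> a /cover[oo|[f <-]]; first by left.
by right; exists f; split; [| exact: A'E | exact: B'E].
Qed.

End Profile.

(** * Comparison of the minimal constants *)

Theorem theorem5p1 (R : realType) (H : completeNormedModType R)
    (dot : {dot H for (@idfun R)}) (hdot : norm_of_inner_product dot)
    (e : nat -> H) (he : orthonormal_basis dot e)
    (alpha : R) (halpha : 0 < alpha) (r : \bar R) (hr : (0 < r)%E) (c C : R) :
  let tau := (alpha + 2^-1)^-1 in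
  let A_norm := approx_qnorm e alpha r in
  let l_norm := coef_qnorm dot e tau%:E r in
  let lower_min := is_minimal_constant (lower_constants setT A_norm l_norm) in
  let upper_min := is_minimal_constant (upper_constants setT A_norm l_norm) in
  (r = tau%:E ->
     (lower_min c <-> c = lower_c1 (2 * alpha + 1) `^ (alpha + 2^-1)) /\
     (upper_min C <-> C = upper_C1 (2 * alpha + 1) `^ (alpha + 2^-1))) /\
  (r = +oo%E ->
     (lower_min c <-> c = lower_c1oo (2 * alpha + 1) `^ (alpha + 2^-1)) /\
     (upper_min C <-> C = upper_C1oo (2 * alpha + 1) `^ (alpha + 2^-1))).
Proof.
have theta_gt0 : 0 < alpha + 2^-1 by rewrite addr_gt0.
have q_gt1 : 1 < 2 * alpha + 1 by rewrite ltrDr mulr_gt0.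
have sum_cover := profile_or_pinfty_sum hdot he halpha.
have sup_cover := profile_or_pinfty_sup hdot he halpha.
move=> tau A_norm l_norm lower_min upper_min.
split=> rE; rewrite /lower_min /upper_min /A_norm /l_norm rE; split;
  rewrite ?is_minimal_lower.
- exact: (is_minimal_constant_profile hdot he halpha
    (@seq_sum_ge0 R) (fun a _ => tail_sum_ge0 _ a)
    (coef_qnorm_tau hdot he halpha) (approx_qnorm_tau hdot he halpha)
    sum_cover (lower_c1_minimal q_gt1)).
- have cover a ha := iffLR (or_iff_compat_r _ (and_comm _ _)) (sum_cover a ha).
  exact: (is_minimal_constant_profile hdot he halpha
    (fun a _ => tail_sum_ge0 _ a) (@seq_sum_ge0 R)
    (approx_qnorm_tau hdot he halpha) (coef_qnorm_tau hdot he halpha)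
    cover (upper_C1_minimal q_gt1)).
- exact: (is_minimal_constant_profile hdot he halpha
    (@seq_sup_ge0 R) (fun a _ => tail_sup_ge0 _ a)
    (coef_qnorm_oo hdot he halpha) (approx_qnorm_oo hdot he halpha)
    sup_cover (lower_c1oo_minimal q_gt1)).
- have cover a ha := iffLR (or_iff_compat_r _ (and_comm _ _)) (sup_cover a ha).
  exact: (is_minimal_constant_profile hdot he halpha
    (fun a _ => tail_sup_ge0 _ a) (@seq_sup_ge0 R)
    (approx_qnorm_oo hdot he halpha) (coef_qnorm_oo hdot he halpha)
    cover (upper_C1oo_minimal q_gt1)).
Qed.
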